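(* Let $k\geq 1$, let $P_{2k}$ be the path with $2k$ vertices and let $H$ be a graph. Then the lexicographic product $P_{2k}[H]$ is hamiltonian connected if and only if $\pi(H)\geq 1$ in the case $k=1$, and $\pi(H)\geq 2$ in the case $k>1$.
   Context: The lexicographic product $G[H]$ has vertex set $V(G)\times V(H)$, with $(g,h)(g',h')$ an edge iff $gg'\in E(G)$, or $g=g'$ and $hh'\in E(H)$. $\pi(H)$ is the maximum number of edges of a spanning linear forest of $H$ (a forest whose components are paths). A graph is hamiltonian connected if every two vertices are joined by a hamiltonian path.
   Formalization: H is assumed to have at least one vertex, and at least two vertices when k=1: for k=1 and H=K_1 the claim fails, since P_2[K_1]=K_2 is hamiltonian connected while π(K_1)=0; the graph without vertices fails likewise. *)

(* Defs.v *)
From HB Require Import structures.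
From mathcomp Require Import all_boot.
From mathcomp Require Import boolp.

Set Implicit Arguments.
Unset Strict Implicit.
Unset Printing Implicit Defensive.

Record sgraph := SGraph {
  vertex :> finType;
  adj : rel vertex;
  adj_sym : symmetric adj;
  adj_irr : irreflexive adj
}.

Definition edges (G : sgraph) : {set {set G}} :=
  [set [set e.1; e.2] | e : G * G & adj e.1 e.2].

Section PathGraph.
Variable n : nat.
Definition path_adj : rel 'I_n := fun i j => (i.+1 == j) || (j.+1 == i).
Lemma path_adj_sym : symmetric path_adj.
Proof. by move=> i j; rewrite /path_adj orbC. Qed.
Lemma path_adj_irr : irreflexive path_adj.
Proof. by move=> i; rewrite /path_adj orbb; apply/negbTE; rewrite neq_ltn ltnSn orbT. Qed.
(* The path with n vertices (not n edges). *)
Definition path_graph : sgraph := SGraph path_adj_sym path_adj_irr.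
End PathGraph.

Section LexProduct.
Variables G H : sgraph.
Definition lex_adj : rel (G * H)%type :=
  fun x y => adj x.1 y.1 || ((x.1 == y.1) && adj x.2 y.2).
Lemma lex_adj_sym : symmetric lex_adj.
Proof. by move=> x y; rewrite /lex_adj adj_sym eq_sym (adj_sym x.2). Qed.
Lemma lex_adj_irr : irreflexive lex_adj.
Proof. by move=> x; rewrite /lex_adj !adj_irr andbF. Qed.
Definition lex_product : sgraph := SGraph lex_adj_sym lex_adj_irr.
End LexProduct.

Section SpanningSubgraph.
Variables (G : sgraph) (F : {set {set G}}).
Definition spanning_adj : rel G := fun x y => adj x y && ([set x; y] \in F).
Lemma spanning_adj_sym : symmetric spanning_adj.
Proof. by move=> x y; rewrite /spanning_adj adj_sym setUC. Qed.
Lemma spanning_adj_irr : irreflexive spanning_adj.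
Proof. by move=> x; rewrite /spanning_adj adj_irr. Qed.
Definition spanning_subgraph : sgraph := SGraph spanning_adj_sym spanning_adj_irr.
End SpanningSubgraph.

Section InducedSubgraph.
Variables (G : sgraph) (A : {set G}).
Definition induced_adj : rel {x : G | x \in A} := fun x y => adj (val x) (val y).
Lemma induced_adj_sym : symmetric induced_adj.
Proof. by move=> x y; rewrite /induced_adj adj_sym. Qed.
Lemma induced_adj_irr : irreflexive induced_adj.
Proof. by move=> x; rewrite /induced_adj adj_irr. Qed.
Definition induced_subgraph : sgraph := SGraph induced_adj_sym induced_adj_irr.
End InducedSubgraph.

Definition graph_iso (G G' : sgraph) : Prop :=
  exists2 f : G -> G', bijective f & forall x y, adj (f x) (f y) = adj x y.

Definition is_path_graph (G : sgraph) : Prop :=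
  exists n : nat, graph_iso (path_graph n) G.

Definition component (G : sgraph) (x : G) : {set G} :=
  [set y | connect (@adj G) x y].

(* [ucycle] also holds of the traversal [:: x; y] of a single edge, so genuine
   cycles are those with at least 3 vertices. *)
Definition forest (G : sgraph) : Prop :=
  forall c : seq G, ucycle (@adj G) c -> size c <= 2.

Definition linear_forest (G : sgraph) : Prop :=
  forest G /\ forall x : G, is_path_graph (induced_subgraph (component x)).

(* The invariant pi(H); a spanning subgraph is given by its edge set F. *)
Definition pi_lf (H : sgraph) : nat :=
  \max_(F : {set {set H}} |
        (F \subset edges H) && `[< linear_forest (spanning_subgraph F) >]) #|F|.

Definition hamiltonian_path (G : sgraph) (x y : G) (p : seq G) : Prop :=
  [/\ path (@adj G) x p, last x p = y, uniq (x :: p)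
    & forall z : G, z \in x :: p].

Definition hamiltonian_connected (G : sgraph) : Prop :=
  forall x y : G, x <> y -> exists p : seq G, hamiltonian_path x y p.

(* Main.v *)
Require Import Defs.
From HB Require Import structures.
From mathcomp Require Import all_boot zify.
From mathcomp Require Import boolp.

(** Any one or two edges form a linear forest, so [1 <= pi H] and [2 <= pi H]
    only say that [H] has at least one, resp. two, edges.

    Necessity: take a hamiltonian path with both ends in the second layer. Each
    maximal run inside the first layer lies between two vertices of the second
    layer. If the first layer contributed no edge, or just one edge while
    further layers also have to be visited, the second layer would need more
    than [#|H|] vertices.

    Sufficiency: group the layers into consecutive pairs. Inside a pair, paths
    with both ends in one layer can be alternated freely with paths with both
    ends in the other one, so only the number of pieces of each layer matters;
    it is lowered by using edges of [H]. An edge [uv] of a layer can moreover be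
    replaced by [u D v], where [D] sweeps all pairs on the far side of that
    layer; this needs only one edge of [H] per pair, and a second one only when
    both ends lie in the same layer. *)

Set Implicit Arguments.
Unset Strict Implicit.
Unset Printing Implicit Defensive.

(** * Linear forests with at most two edges *)

Lemma set2_eqP (T : finType) (a b c d : T) :
  reflect ((a = c /\ b = d) \/ (a = d /\ b = c)) ([set a; b] == [set c; d]).
Proof.
apply: (iffP eqP) => [/setP e|[[-> ->]|[-> ->]] //]; last exact: setUC.
have := e a; have := e b; have := e c; have := e d; rewrite !inE !eqxx ?orbT /=.
by do 4![case: eqP => //= ?; subst => //=]; auto; do ?[case: eqP => //= ?]; subst; auto.
Qed.

Lemma mem_edges (G : sgraph) (x y : G) : ([set x; y] \in edges G) = adj x y.
Proof.
apply/imsetP/idP => [[[a b]]|axy]; last by exists (x, y); rewrite ?inE.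
by rewrite inE /= => ab /eqP /set2_eqP [[-> ->]|[-> ->]] //; rewrite adj_sym.
Qed.

Lemma edgesP (G : sgraph) (e : {set G}) :
  reflect (exists x y, adj x y /\ e = [set x; y]) (e \in edges G).
Proof.
apply: (iffP idP) => [/imsetP[[a b]]|[x [y [xy ->]]]]; last by rewrite mem_edges.
by rewrite inE /= => ab ->; exists a, b.
Qed.

Lemma adj_neq (G : sgraph) (x y : G) : adj x y -> x != y.
Proof. by apply: contraTneq => ->; rewrite adj_irr. Qed.

Lemma edges_spanning (G : sgraph) (F : {set {set G}}) :
  edges (spanning_subgraph F) \subset F.
Proof. by apply/subsetP => e /edgesP[x [y [/andP[_ xyF] ->]]]. Qed.

Lemma uniq_leq_edges (G : sgraph) (s : seq {set G}) :
  uniq s -> {subset s <= edges G} -> size s <= #|edges G|.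
Proof. by move=> us sE; rewrite cardE uniq_leq_size // => e /sE; rewrite mem_enum. Qed.

(** A cycle on three or more vertices has three distinct edges: its first two and the closing
    one. *)
Lemma forest_edges_le2 (G : sgraph) : #|edges G| <= 2 -> forest G.
Proof.
move=> le2 [|x [|y [|z t]]] // /andP[/= c u].
move: u c; rewrite rcons_path /= !inE !negb_or.
move=> /and4P[/and3P[xy xz xt] /andP[yz yt] zt _] /and4P[axy ayz _ al].
have lzt : last z t \in z :: t by exact: mem_last.
have xl : x != last z t by apply: contraTneq lzt => <-; rewrite inE negb_or xz.
have yl : y != last z t by apply: contraTneq lzt => <-; rewrite inE negb_or yz.
suff : 3 <= #|edges G| by lia.
apply: (@uniq_leq_edges G [:: [set x; y]; [set y; z]; [set last z t; x]]).
  rewrite /= !inE negb_or andbT -andbA; apply/and3P; split;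
  apply/set2_eqP => -[[? ?]|[? ?]]; subst; by move: xy xz yz xl yl; rewrite ?eqxx.
by move=> e; rewrite !inE => /or3P[] /eqP->; rewrite mem_edges.
Qed.

(** Closure under adjacency keeps the component inside [s], and consecutive entries link all of [s]
    together; [nth] and [index] give the isomorphism. *)
Lemma is_path_component (G : sgraph) (x : G) (s : seq G) :
  uniq s -> x \in s ->
  (forall a b, a \in s -> adj a b -> b \in s) ->
  (forall i j, i < size s -> j < size s ->
     adj (nth x s i) (nth x s j) = (i.+1 == j) || (j.+1 == i)) ->
  is_path_graph (induced_subgraph (component x)).
Proof.
move=> us xs cl pat.
have compE y : (y \in component x) = (y \in s).
  rewrite inE; apply/idP/idP => [/connectP[p]|ys].
    elim: p x xs {pat} => [|z p IH] a as_ /=; first by move=> _ ->.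
    by move=> /andP[/(cl _ _ as_) zs /(IH _ zs)].
  have c0 i : i < size s -> connect (@adj G) (nth x s 0) (nth x s i).
    elim: i => [|i IH] lti //; apply: connect_trans (IH (ltnW lti)) _.
    by apply: connect1; rewrite pat ?eqxx // ltnW.
  have sym : connect_sym (@adj G) by apply: sym_connect_sym; exact: adj_sym.
  rewrite -(nth_index x xs) -[in X in connect _ _ X](nth_index x ys).
  by apply: connect_trans (c0 _ _); rewrite ?index_mem // sym c0 // index_mem.
have memf (i : 'I_(size s)) : nth x s i \in component x by rewrite compE mem_nth.
exists (size s), (fun i : 'I_(size s) => exist _ (nth x s i) (memf i)) => [|i j]; last exact: pat.
have memg (y : {y | y \in component x}) : index (val y) s < size s.
  by rewrite index_mem -compE (valP y).
exists (fun y => Ordinal (memg y)) => [i|y]; apply: val_inj => /=.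
  by rewrite index_uniq.
by rewrite nth_index // -compE (valP y).
Qed.

Lemma is_path_component3 (G : sgraph) (x a b c : G) :
  #|edges G| <= 2 -> adj a b -> adj b c -> a != c -> x \in [:: a; b; c] ->
  is_path_graph (induced_subgraph (component x)).
Proof.
move=> le2 ab bc ac xs.
have ab' := adj_neq ab; have bc' := adj_neq bc.
have abc : uniq [:: a; b; c] by rewrite /= !inE negb_or ab' ac bc'.
have only p q : adj p q -> [set p; q] = [set a; b] \/ [set p; q] = [set b; c].
  move=> pq; case: (eqVneq [set p; q] [set a; b]) => [|n1]; first by left.
  case: (eqVneq [set p; q] [set b; c]) => [|n2]; first by right.
  suff : 3 <= #|edges G| by lia.
  apply: (@uniq_leq_edges G [:: [set p; q]; [set a; b]; [set b; c]]).
    rewrite /= !inE negb_or n1 n2 !andbT /=; apply/set2_eqP => -[[? ?]|[? ?]]; subst.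
      by rewrite eqxx in ab'.
    by rewrite eqxx in ac.
  by move=> e; rewrite !inE => /or3P[] /eqP->; rewrite mem_edges.
have nac : adj a c = false.
  apply/negP => /only[] /eqP/set2_eqP [[? ?]|[? ?]]; subst;
  by move: ab' bc' ac; rewrite ?eqxx.
apply: (@is_path_component G x [:: a; b; c]) => //.
  move=> p q _ /only[] /setP /(_ q); rewrite !inE eqxx orbT => /esym.
    by rewrite orbA => ->.
  by move=> ->; rewrite orbT.
by move=> [|[|[|?]]] [|[|[|?]]] //= _ _; rewrite ?adj_irr // ?(adj_sym b) ?(adj_sym c) ?ab
  ?(adj_sym b) ?bc ?(adj_sym c) ?nac.
Qed.

Lemma linear_forest_edges_le2 (G : sgraph) : #|edges G| <= 2 -> linear_forest G.
Proof.
move=> le2; split=> [|x]; first exact: forest_edges_le2.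
(* Cases: [x] is isolated, the middle of a two-edge path, the end of one, or on an isolated edge. *)
case: (pickP (adj x)) => [y xy|nox]; last first.
  apply: (@is_path_component G x [:: x]) => //; first by rewrite inE.
    by move=> a b /[!inE] /eqP-> ; rewrite nox.
  by move=> [|i] [|j] //= _ _; rewrite adj_irr.
case: (pickP (fun z => adj x z && (y != z))) => [z /andP[xz yz]|nox].
  by apply: (@is_path_component3 G x y x z); rewrite // ?(adj_sym y) // !inE eqxx orbT.
case: (pickP (fun z => adj y z && (x != z))) => [z /andP[yz xz]|noy].
  by apply: (@is_path_component3 G x x y z); rewrite // !inE eqxx.
apply: (@is_path_component G x [:: x; y]).
- by rewrite /= inE (adj_neq xy).
- by rewrite inE eqxx.
- move=> a b; rewrite !inE => /orP[] /eqP-> ab.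
    by have := nox b; rewrite ab /= => /negbFE /eqP->; rewrite eqxx orbT.
  by have := noy b; rewrite ab /= => /negbFE /eqP->; rewrite eqxx.
by move=> [|[|?]] [|[|?]] //= _ _; rewrite ?adj_irr // adj_sym.
Qed.

Lemma leq_pi_lf (H : sgraph) n : n <= 2 -> (n <= pi_lf H) = (n <= #|edges H|).
Proof.
move=> n2; apply/idP/idP => [le|nE].
  apply: leq_trans le _; apply/bigmax_leqP => F /andP[FE _].
  exact: subset_leq_card.
have [F FE Fn] : exists2 F : {set {set H}}, F \subset edges H & #|F| = n.
  exists [set e in take n (enum (edges H))].
    by apply/subsetP => e /[!inE] /mem_take; rewrite mem_enum.
  rewrite cardsE (card_uniqP _) ?take_uniq ?enum_uniq // size_take -cardE.
  by case: ltngtP nE => // /[swap] ->.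
rewrite -{1}Fn /pi_lf; apply: (@leq_bigmax_cond _ _ (fun F : {set {set H}} => #|F|)).
rewrite FE /=; apply/asboolP; apply: linear_forest_edges_le2.
by apply: leq_trans n2; rewrite -Fn subset_leq_card // edges_spanning.
Qed.

(** * Necessity *)

Section Counting.
Variables (m : nat) (H : sgraph).
Let V := (lex_product (path_graph m) H).
Implicit Types (x y : V) (p : seq V).

Definition in_layer (j : nat) : pred V := fun z => val z.1 == j.
Definition beyond_layer1 : pred V := fun z => 1 < val z.1.

(** A list rather than a set, so that its size is the number of steps of the path inside layer 0. *)
Fixpoint layer0_edges (x : V) (p : seq V) : seq {set H} :=
  if p is y :: q then
    (if in_layer 0 x && in_layer 0 y then [:: [set x.2; y.2]] else [::])
      ++ layer0_edges y q
  else [::].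

Lemma in_layer0_inj x y : in_layer 0 x -> in_layer 0 y -> x.2 = y.2 -> x = y.
Proof.
case: x y => [i h] [j g] /= /eqP /= i0 /eqP /= j0 ->; congr pair.
by apply: val_inj; rewrite /= i0 j0.
Qed.

Lemma mem_layer0_edges x p e h : e \in layer0_edges x p -> h \in e ->
  exists2 z, z \in x :: p & in_layer 0 z /\ z.2 = h.
Proof.
elim: p x => [|y q IH] x //=; rewrite mem_cat => /orP[|/IH{}IH he].
  case: ifP => // /andP[x0 y0]; rewrite inE => /eqP-> /set2P[] ->.
    by exists x; rewrite ?mem_head.
  by exists y; rewrite // !inE eqxx orbT.
by have [z zq ?] := IH he; exists z; rewrite // inE zq orbT.
Qed.

(** The traced edges are distinct: the edge of the first step contains [x.2], and its reappearance
    would make the path revisit [x]. *)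
Lemma size_layer0_edges x p : path (@adj V) x p -> uniq (x :: p) ->
  size (layer0_edges x p) <= #|edges H|.
Proof.
move=> px ux; apply: uniq_leq_edges.
  elim: p x px ux => [|y q IH] x //= /andP[_ yq] /andP[xq uq].
  case: ifP => [/andP[x0 y0]|_]; rewrite /= IH // andbT.
  apply/negP => /mem_layer0_edges /(_ (set21 _ _)) [z zq [z0 zx]].
  by move: xq; rewrite -(in_layer0_inj z0 x0 zx) zq.
elim: p x px {ux} => [|y q IH] x //= /andP[xy /IH{}IH] e.
rewrite mem_cat => /orP[|/IH //]; case: ifP => // /andP[/eqP x0 /eqP y0].
rewrite inE => /eqP->; rewrite mem_edges; move: xy.
by rewrite /= /lex_adj /= /path_adj x0 y0 /= => /andP[].
Qed.

(* Every maximal run inside layer 0 is followed by a vertex of layer 1, and so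
   is every excursion beyond layer 1. *)
Lemma layer0_count x p : path (@adj V) x p -> in_layer 1 (last x p) ->
  (in_layer 0 x || beyond_layer1 x) + count (in_layer 0) p
    + (has beyond_layer1 p && ~~ beyond_layer1 x)
  <= size (layer0_edges x p) + count (in_layer 1) p.
Proof.
elim: p x => [|y q IH] x /=.
  by rewrite /in_layer /beyond_layer1 => _ /eqP->.
move=> /andP[xy yq] /(IH _ yq) {IH}; rewrite size_cat.
move: xy; rewrite /= /lex_adj /= /path_adj /in_layer /beyond_layer1 /=.
case: x y {yq} => [[i lti] h] [[j ltj] g] /=.
move: (size (layer0_edges _ _)) (has _ q) (count _ q) (count _ q) => e b c0 c1.
rewrite -val_eqE /=.
move=> hij; have {hij} : (i.+1 == j) || (j.+1 == i) || (i == j).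
  by case/orP: hij => [->|/andP[->]]; rewrite ?orbT.
(* Only the classes layer 0, layer 1 and beyond matter; no step joins layer 0 to the layers beyond
   1. *)
case: i {lti} => [|[|i]]; case: j {ltj} => [|[|j]] //=; case: b => /=; lia.
Qed.

Lemma count_layer (s : seq V) j : uniq s -> (forall z, z \in s) -> j < m ->
  count (in_layer j) s = #|H|.
Proof.
move=> us cov ltj; rewrite -size_filter -(card_uniqP (filter_uniq _ us)).
rewrite -(card_imset (mem H) (f := fun h => (Ordinal ltj, h) : V)); last by move=> a b [].
apply: eq_card => -[i h]; rewrite mem_filter cov andbT /in_layer /=.
apply/eqP/imsetP => [ij|[h' _ [-> _]] //]; exists h => //.
by congr pair; apply: val_inj.
Qed.

(** The bound is 1 for [m = 2] and 2 for larger [m]. For [m = 2] and a one-vertex [H] the product is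
    a single edge, hamiltonian connected although [H] has no edge; [H2] excludes this case. *)
Lemma hamiltonian_connected_edges : 1 < m -> 0 < #|H| -> (m = 2 -> 1 < #|H|) ->
  hamiltonian_connected V -> (2 < m).+1 <= #|edges H|.
Proof.
move=> m1 H0 H2 hc.
have m0 : 0 < m by exact: ltnW.
have hasb x p : (forall z, z \in x :: p) -> ~~ beyond_layer1 x ->
    has beyond_layer1 p = (2 < m).
  move=> cov xb; case: (ltnP 2 m) => m2.
    have /card_gt0P[h _] := H0.
    apply/hasP; exists ((Ordinal m2, h) : V) => //.
    by have := cov ((Ordinal m2, h) : V); rewrite inE => /orP[/eqP e|//]; rewrite -e in xb.
  apply/negP => /hasP[[[i lti] h] _]; rewrite /beyond_layer1 /=; lia.
(* With both ends in layer 1, [p] has [#|H|] vertices in layer 0 but only [#|H|.-1] in layer 1;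
   [layer0_count] turns the deficit into edges. *)
case: (ltnP 1 #|H|) => H1.
  have /card_gt1P[a [b [_ _ ab]]] := H1.
  pose x : V := (Ordinal m1, a); pose y : V := (Ordinal m1, b).
  have [|p [px pl pu cov]] := hc x y; first by case; apply/eqP.
  have := layer0_count px; rewrite pl => /(_ isT).
  have := size_layer0_edges px pu.
  have := count_layer pu cov m0; have := count_layer pu cov m1.
  rewrite /= (hasb x) // /x /in_layer /beyond_layer1 /=; lia.
(* For a one-vertex [H], a path from layer 0 to layer 1 that also visits layer 2 would force an
   edge, hence a second vertex. *)
have m2 : 2 < m by move: H2; case: (ltngtP 2 m) => // [|<- /(_ erefl)]; lia.
have /card_gt0P[a _] := H0.
pose x : V := (Ordinal m0, a); pose y : V := (Ordinal m1, a).
have [|p [px pl pu cov]] := hc x y; first by case.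
have := layer0_count px; rewrite pl => /(_ isT).
have := size_layer0_edges px pu.
have := count_layer pu cov m0; have := count_layer pu cov m1.
rewrite /= (hasb x) // m2 /x /in_layer /beyond_layer1 /= => c1 c0 le cnt.
have : 0 < #|edges H| by apply: leq_trans le; lia.
case/card_gt0P => e /edgesP[u [v [/adj_neq uv _]]].
suff : 1 < #|H| by lia.
by apply/card_gt1P; exists u, v.
Qed.
End Counting.

(** * Sufficiency *)

(** Permutations of concatenations become linear equations between the counts of an arbitrary
    predicate. *)
Ltac perm_lia :=
  repeat match goal with h : is_true (perm_eq _ _) |- _ => move/permP: h => h end;
  let a := fresh in apply/permP => a;
  repeat match goal with h : eqfun _ _ |- _ => move: {h} (h a) end;
  repeat match goal with h : is_true _ |- _ => clear h end;
  rewrite ?(count_cat, count_map) /= ?(count_cat, count_map) /=; lia.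

(** Distinctness is not part of the notion: it is read off at the end, together with covering, from
    the list of all vertices. *)
Definition hpath (V : sgraph) (x y : V) (l : seq V) : Prop :=
  exists p, [/\ path (@adj V) x p, last x p = y & perm_eq (x :: p) l].

Section Hpath.
Variable V : sgraph.
Implicit Types (x y z : V) (l : seq V).

Lemma hpath_perm x y l l' : perm_eq l l' -> hpath x y l -> hpath x y l'.
Proof. by move=> ll' [p [px pl pp]]; exists p; split=> //; apply: perm_trans ll'. Qed.

Lemma hpath1 x : hpath x x [:: x].
Proof. by exists [::]. Qed.

Lemma hpath_cat x y z w l l' :
  hpath x y l -> adj y z -> hpath z w l' -> hpath x w (l ++ l').
Proof.
move=> [p [px pl pp]] yz [q [qz ql qq]]; exists (p ++ z :: q); split.
- by rewrite cat_path px /= pl yz.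
- by rewrite last_cat.
- by perm_lia.
Qed.

Lemma hpath_sym x y l : hpath x y l -> hpath y x l.
Proof.
move=> [p [px <- pp]]; exists (rev (belast x p)); split.
- by rewrite rev_path (eq_path (e' := @adj V)) // => a b; rewrite adj_sym.
- by case: p {px pp} => //= z p; rewrite rev_cons last_rcons.
- apply: perm_trans pp; rewrite -rev_rcons -lastI.
  by rewrite perm_rev.
Qed.
End Hpath.

(** * Alternating between the pieces of two adjacent layers *)

Section Weave.
Variables G H : sgraph.
Local Notation V := (lex_product G H).
Implicit Types (i j : G) (x y u v : H) (l D : seq V).

Lemma lex_adj_layers i j x y : adj i j -> @adj V (i, x) (j, y).
Proof. by move=> ij; rewrite /= /lex_adj ij. Qed.

Lemma lex_adj_in i x y : adj x y -> @adj V (i, x) (i, y).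
Proof. by move=> xy; rewrite /= /lex_adj /= eqxx xy orbT. Qed.

(* [n] vertex-disjoint paths, each with both ends in layer [i], the first one
   starting at [x] and the last one ending at [y]; [l] lists all their vertices. *)
Inductive chain i : H -> H -> nat -> seq V -> Prop :=
| chain_one x y l : hpath ((i, x) : V) (i, y) l -> chain i x y 1 l
| chain_cons x z w y n l l' l'' : hpath ((i, x) : V) (i, z) l ->
    chain i w y n l' -> perm_eq (l ++ l') l'' -> chain i x y n.+1 l''.

Lemma chain_gt0 i x y n l : chain i x y n l -> 0 < n.
Proof. by case. Qed.

Lemma chain_perm i x y n l l' : perm_eq l l' -> chain i x y n l -> chain i x y n l'.
Proof.
move=> + c; case: c => [{}x {}y {}l h|{}x z w {}y {}n {}l l1 l2 h c p] ll'.
  by apply: chain_one; apply: hpath_perm h.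
by apply: chain_cons h c _; apply: perm_trans ll'.
Qed.

Lemma chain_cat i x y z w n n' l l' :
  chain i x y n l -> chain i z w n' l' -> chain i x w (n + n') (l ++ l').
Proof.
move=> c c'; elim: c => [{}x {}y {}l h|{}x a b {}y {}n {}l l1 l2 h _ IH p].
  by apply: chain_cons h c' _.
by rewrite addSn; apply: chain_cons h IH _; perm_lia.
Qed.

Lemma chain_sym i x y n l : chain i x y n l -> chain i y x n l.
Proof.
elim=> [{}x {}y {}l /hpath_sym h|{}x a b {}y {}n {}l l1 l2 /hpath_sym h _ IH p].
  exact: chain_one.
rewrite -addn1; apply: chain_perm (chain_cat IH (chain_one h)); perm_lia.
Qed.

Lemma chain_single i x : chain i x x 1 [:: (i, x)].
Proof. by apply: chain_one; apply: hpath1. Qed.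

Lemma chain_catl i x y n l (s : seq H) : chain i x y n l ->
  exists z, chain i x z (n + size s) (l ++ map (pair i) s).
Proof.
move=> c; elim/last_ind: s => [|s a [z IH]]; first by exists y; rewrite addn0 cats0.
exists a; rewrite size_rcons -addn1 addnA.
by apply: chain_perm (chain_cat IH (chain_single i a)); rewrite map_rcons -cats1; perm_lia.
Qed.

Lemma chain_insert i x y z w n n' l l' (s : seq H) :
  chain i x y n l -> chain i z w n' l' ->
  chain i x w (n + size s + n') (l ++ map (pair i) s ++ l').
Proof.
move=> /(chain_catl s)[t c] c'; rewrite catA; exact: chain_cat c c'.
Qed.

(** Adjacent layers are completely joined, so pieces can be visited alternately whatever their ends;
    with equal numbers the last piece lies in layer [j]. *)
Lemma weave_eq i j x y x' y' n l l' : adj i j ->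
  chain i x y n l -> chain j x' y' n l' -> hpath ((i, x) : V) (j, y') (l ++ l').
Proof.
move=> ij c; elim: c x' y' l' => [{}x {}y {}l h|{}x a b {}y {}n {}l l1 l2 h c IH p] x' y' l' c'.
  inversion c' as [? ? ? h'|? ? ? ? ? ? ? ? h' c'']; subst.
    exact: hpath_cat h (lex_adj_layers _ _ ij) h'.
  by move: (chain_gt0 c'').
inversion c' as [? ? ? h'|? z w ? ? s s' ? h' c'' p']; subst.
  by move: (chain_gt0 c).
have ji : adj j i by rewrite adj_sym.
have := hpath_cat (hpath_cat h (lex_adj_layers _ _ ij) h') (lex_adj_layers _ _ ji)
  (IH _ _ _ c'').
by apply: hpath_perm; perm_lia.
Qed.

(** After the first piece in layer [i], equally many pieces of both layers remain; they are woven
    starting from [j]. *)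
Lemma weave_succ i j x y x' y' n l l' : adj i j ->
  chain i x y n.+1 l -> chain j x' y' n l' -> hpath ((i, x) : V) (i, y) (l ++ l').
Proof.
move=> ij c c'; have n0 := chain_gt0 c'.
inversion c as [? ? ? h|? a b ? ? s s' ? h c'' p]; subst; first by [].
have ji : adj j i by rewrite adj_sym.
have := hpath_cat h (lex_adj_layers _ _ ij) (weave_eq ji c' c'').
by apply: hpath_perm; perm_lia.
Qed.

(* A vertex set [D] that can be visited by a detour between any two vertices of
   layer [i]. *)
Definition pocket i D : Prop :=
  D = [::] \/ exists c d : V, [/\ hpath c d D, forall x, @adj V (i, x) c
                                 & forall x, @adj V d (i, x)].

Lemma pocket_nil i : pocket i [::].
Proof. by left. Qed.

(** Joins [u] and [v] into one piece that also absorbs [D]: by the edge itself if [D] is empty, by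
    the detour otherwise. *)
Lemma chain_edge i u v D : pocket i D -> adj u v ->
  chain i u v 1 (D ++ [:: (i, u); (i, v)]).
Proof.
move=> pD uv; apply: chain_one; case: pD => [->|[c [d [h ac ad]]]].
  exact: (hpath_cat (hpath1 ((i, u) : V)) (lex_adj_in i uv) (hpath1 ((i, v) : V))).
have := hpath_cat (hpath_cat (hpath1 ((i, u) : V)) (ac u) h) (ad v) (hpath1 ((i, v) : V)).
by apply: hpath_perm; perm_lia.
Qed.

(** * Splitting a whole layer into few pieces *)

Definition layers (s : seq G) : seq V := [seq (i, x) | i <- s, x <- enum H].
Definition layer i : seq V := map (pair i) (enum H).

Lemma layers_cons i s : layers (i :: s) = layer i ++ layers s.
Proof. by []. Qed.

Lemma layers_cat s s' : layers (s ++ s') = layers s ++ layers s'.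
Proof. by rewrite /layers map_cat flatten_cat. Qed.

Lemma enum_split (r : seq H) : uniq r ->
  exists s, perm_eq (r ++ s) (enum H) /\ #|H| = size r + size s.
Proof.
move=> ur; exists [seq h <- enum H | h \notin r].
have p : perm_eq (r ++ [seq h <- enum H | h \notin r]) (enum H).
  apply: uniq_perm (enum_uniq H) _ => [|h].
    rewrite cat_uniq ur filter_uniq ?enum_uniq // andbT /=.
    by apply/hasPn => h; rewrite mem_filter => /andP[].
  by rewrite mem_cat mem_filter mem_enum andbT orbN.
by split=> //; rewrite cardE -(perm_size p) size_cat.
Qed.

Lemma layer_split i (r s : seq H) : perm_eq (r ++ s) (enum H) ->
  perm_eq (map (pair i) r ++ map (pair i) s) (layer i).
Proof. by move=> p; rewrite -map_cat; apply: perm_map. Qed.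

Lemma chain_layer i x y : x != y -> chain i x y #|H| (layer i).
Proof.
move=> xy; have [|s [/(layer_split i) p ->]] := @enum_split [:: x; y].
  by rewrite /= inE xy.
have -> : size [:: x; y] + size s = 1 + size s + 1 by rewrite addn1.
by apply: chain_perm (chain_insert s (chain_single i x) (chain_single i y)); perm_lia.
Qed.

(** One edge of [H] merges two vertices into one piece. Only the start is prescribed: two prescribed
    ends could be those of the only edge. *)
Lemma chain_layer_edge_from i D x : pocket i D -> 0 < #|edges H| ->
  exists y, chain i x y #|H|.-1 (D ++ layer i).
Proof.
move=> pD /card_gt0P[e /edgesP[u [v [uv _]]]].
have key a b : adj a b -> exists y, chain i a y #|H|.-1 (D ++ layer i).
  move=> ab; have [|s [/(layer_split i) p ->]] := @enum_split [:: a; b].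
    by rewrite /= inE (adj_neq ab).
  have [y c] := chain_catl s (chain_edge pD ab).
  by exists y; apply: chain_perm c; perm_lia.
case: (eqVneq x u) => [->|xu]; first exact: key uv.
case: (eqVneq x v) => [->|xv]; first by apply: (key v u); rewrite adj_sym.
have [|s [/(layer_split i) p ->]] := @enum_split [:: x; u; v].
  by rewrite /= !inE negb_or xu xv (adj_neq uv).
have [y c] := chain_catl s (chain_cat (chain_single i x) (chain_edge pD uv)).
by exists y; apply: chain_perm c; perm_lia.
Qed.

(** The merging edge must differ from [xy], which would put both ends into the same piece; one of
    two edges does. *)
Lemma chain_layer_edge i D x y : pocket i D -> x != y -> 1 < #|edges H| ->
  chain i x y #|H|.-1 (D ++ layer i).
Proof.
move=> pD xy /card_gt1P[e [f [eE fE ef]]].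
have [u [v [uv nuv]]] : exists u v, adj u v /\ [set u; v] != [set x; y].
  have [/eqP exy|nexy] := boolP (e == [set x; y]).
    have /edgesP[u [v [uv fuv]]] := fE; exists u, v; split=> //.
    by rewrite -fuv -exy eq_sym.
  by have /edgesP[u [v [uv euv]]] := eE; exists u, v; split; rewrite // -euv.
have key a b c : adj a b -> a != c -> b != c -> chain i a c #|H|.-1 (D ++ layer i).
  move=> ab ac bc; have [|s [/(layer_split i) p ->]] := @enum_split [:: a; b; c].
    by rewrite /= !inE negb_or ac bc (adj_neq ab).
  have -> : (size [:: a; b; c] + size s).-1 = 1 + size s + 1 by rewrite addn1.
  by apply: chain_perm (chain_insert s (chain_edge pD ab) (chain_single i c)); perm_lia.
have vu : adj v u by rewrite adj_sym.
have yx : y != x by rewrite eq_sym.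
have [xu|xu] := eqVneq u x.
  rewrite xu in uv nuv; apply: key uv xy _.
  by apply: contraNneq nuv => ->.
have [xv|xv] := eqVneq v x.
  rewrite xv in vu nuv; apply: key vu xy _.
  by apply: contraNneq nuv => ->; rewrite setUC.
have [yu|yu] := eqVneq u y; first by apply: chain_sym; apply: (key _ v); rewrite -?yu // yu.
have [yv|yv] := eqVneq v y; first by apply: chain_sym; apply: (key _ u); rewrite -?yv // yv.
have [|s [/(layer_split i) p ->]] := @enum_split [:: x; u; v; y].
  by rewrite /= !inE !negb_or xy yu yv (adj_neq uv) eq_sym xu eq_sym xv.
have -> : (size [:: x; u; v; y] + size s).-1 = (1 + 1) + size s + 1 by rewrite addn1.
apply: chain_perm (chain_insert s (chain_cat (chain_single i x) (chain_edge pD uv))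
  (chain_single i y)); perm_lia.
Qed.

Lemma two_edges_cases : 1 < #|edges H| ->
  (exists u v w, [/\ adj u v, adj v w & uniq [:: u; v; w]]) \/
  (exists u v w z, [/\ adj u v, adj w z & uniq [:: u; v; w; z]]).
Proof.
move=> /card_gt1P[e [f [/edgesP[u [v [uv ->]]] /edgesP[w [z [wz ->]]]]]].
have key (a b c : H) : adj a b -> adj b c -> [set a; b] != [set b; c] ->
    exists u v w, [/\ adj u v, adj v w & uniq [:: u; v; w]].
  move=> ab bc n; exists a, b, c; split=> //.
  rewrite /= !inE negb_or (adj_neq ab) (adj_neq bc) !andbT.
  by apply: contraNneq n => ->; rewrite setUC.
have vu : adj v u by rewrite adj_sym.
have zw : adj z w by rewrite adj_sym.
move=> n.
have [e1|uw] := eqVneq u w.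
  by rewrite -e1 in n wz; left; apply: (key v u z); rewrite // setUC.
have [e1|uz] := eqVneq u z.
  by rewrite -e1 in n zw; left; apply: (key v u w); rewrite // setUC [X in _ != X]setUC.
have [e1|vw] := eqVneq v w.
  by rewrite -e1 in n wz; left; apply: (key u v z).
have [e1|vz] := eqVneq v z.
  by rewrite -e1 in n zw; left; apply: (key u v w); rewrite // [X in _ != X]setUC.
right; exists u, v, w, z; split=> //.
by rewrite /= !inE !negb_or uw uz vw vz (adj_neq uv) (adj_neq wz).
Qed.

(** Two edges save two pieces, as one piece on three vertices or as two pieces on two; the pocket
    hangs on the edge [uv] alone. *)
Lemma chain_layer_two_edges i D : pocket i D -> 1 < #|edges H| ->
  exists x y, chain i x y #|H|.-2 (D ++ layer i).
Proof.
move=> pD /two_edges_cases[[u [v [w [uv vw u3]]]]|[u [v [w [z [uv wz u4]]]]]].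
  have [s [/(layer_split i) p ->]] := enum_split u3.
  have c1 : chain i u w 1 (D ++ [:: (i, u); (i, v); (i, w)]).
    apply: chain_one; have := chain_edge pD uv => c.
    inversion c as [? ? ? h|? ? ? ? ? ? ? ? _ c']; subst.
      have := hpath_cat h (lex_adj_in i vw) (hpath1 ((i, w) : V)).
      by apply: hpath_perm; perm_lia.
    by move: (chain_gt0 c').
  have [y c] := chain_catl s c1.
  by exists u, y; apply: chain_perm c; perm_lia.
have [s [/(layer_split i) p ->]] := enum_split u4.
have [y c] := chain_catl s (chain_cat (chain_edge pD uv) (chain_edge (pocket_nil i) wz)).
by exists u, y; apply: chain_perm c; perm_lia.
Qed.

Lemma edges_card_gt1 : 0 < #|edges H| -> 1 < #|H|.
Proof.
by case/card_gt0P => e /edgesP[u [v [/adj_neq uv _]]]; apply/card_gt1P; exists u, v.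
Qed.

Lemma two_edges_card_gt2 : 1 < #|edges H| -> 2 < #|H|.
Proof.
move=> /two_edges_cases[[u [v [w [_ _ u3]]]]|[u [v [w [z [_ _ u4]]]]]].
  by have [s [_ ->]] := enum_split u3.
by have [s [_ ->]] := enum_split u4.
Qed.

(** * Paths covering a pair of layers and its pockets *)

Lemma hpath_same i j D x y : adj i j -> pocket j D -> 0 < #|edges H| -> x != y ->
  hpath ((i, x) : V) (i, y) (D ++ layer i ++ layer j).
Proof.
move=> ij pD E xy; have n1 := edges_card_gt1 E.
(* Layer [i] merges nothing and layer [j] one pair of vertices, absorbing [D] there, so [i] has
   exactly one piece more. *)
have c := chain_layer i xy; have [z c'] := chain_layer_edge_from x pD E.
have nE : #|H| = #|H|.-1.+1 by lia.
rewrite nE in c; have := weave_succ ij c c'.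
by apply: hpath_perm; perm_lia.
Qed.

(** One edge in each layer absorbs the pocket there and leaves [#|H|.-1] pieces on both sides. *)
Lemma hpath_cross i j D D' x y : adj i j -> pocket i D -> pocket j D' ->
  0 < #|edges H| ->
  hpath ((i, x) : V) (j, y) (D ++ D' ++ layer i ++ layer j).
Proof.
move=> ij pD pD' E.
have [z c] := chain_layer_edge_from x pD E.
have [w /chain_sym c'] := chain_layer_edge_from y pD' E.
by have := weave_eq ij c c'; apply: hpath_perm; perm_lia.
Qed.

(** Absorbing [D] already costs layer [i] a piece, so layer [j] has to lose two, hence two edges of
    [H]. *)
Lemma hpath_same2 i j D D' x y : adj i j -> pocket i D -> pocket j D' ->
  1 < #|edges H| -> x != y ->
  hpath ((i, x) : V) (i, y) (D ++ D' ++ layer i ++ layer j).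
Proof.
move=> ij pD pD' E xy; have n2 := two_edges_card_gt2 E.
have c := chain_layer_edge pD xy E; have [z [w c']] := chain_layer_two_edges pD' E.
have nE : #|H|.-1 = #|H|.-2.+1 by lia.
rewrite nE in c; have := weave_succ ij c c'.
by apply: hpath_perm; perm_lia.
Qed.

Lemma exists_other x : 1 < #|H| -> exists y, x != y.
Proof.
move=> /card_gt1P[a [b [_ _ ab]]]; have [xa|] := eqVneq x a; last by exists a.
by exists b; rewrite xa.
Qed.

(** For passing through a pair entered in either layer; as the end [y] is free, it can be chosen
    different from [x] when [a = j]. *)
Lemma hpath_exit i j D x a : adj i j -> pocket i D -> 0 < #|edges H| ->
  a \in [:: i; j] ->
  exists y, hpath ((a, x) : V) (j, y) (D ++ layer i ++ layer j).
Proof.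
move=> ij pD E; rewrite !inE => /orP[] /eqP->.
  by exists x; apply: hpath_cross (pocket_nil j) E.
have [y xy] := exists_other x (edges_card_gt1 E).
have ji : adj j i by rewrite adj_sym.
by exists y; apply: hpath_perm (hpath_same ji pD E xy); perm_lia.
Qed.

(** A path with both ends in layer [j] is a detour for layer [t], as these layers are completely
    joined; [D] is absorbed in layer [i]. *)
Lemma pocket_extend i j t D : adj i j -> adj j t -> pocket i D -> 0 < #|edges H| ->
  pocket t (D ++ layer i ++ layer j).
Proof.
move=> ij jt pD E.
have ji : adj j i by rewrite adj_sym.
have tj : adj t j by rewrite adj_sym.
have /card_gt1P[a [b [_ _ ab]]] := edges_card_gt1 E.
right; exists (j, a), (j, b); split=> [|x|x]; try exact: lex_adj_layers.
by apply: hpath_perm (hpath_same ji pD E ab); perm_lia.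
Qed.
End Weave.

Lemma pocket_perm (G H : sgraph) (i : G) (D D' : seq (lex_product G H)) :
  perm_eq D D' -> pocket i D -> pocket i D'.
Proof.
move=> DD' [D0|[c [d [h ac ad]]]].
  by left; apply/perm_nilP; rewrite perm_sym -D0.
by right; exists c, d; split=> //; apply: hpath_perm h.
Qed.

(** * Joining the pairs of layers along the path *)

Section Assembly.
Variables (m : nat) (H : sgraph) (i0 : 'I_m).
Local Notation G := (path_graph m).
Local Notation V := (lex_product G H).
Hypothesis E : 0 < #|edges H|.

(** [i0] is only the default value for [j] out of range. *)
Definition pos (j : nat) : G := insubd i0 j.

Lemma val_pos j : j < m -> val (pos j) = j.
Proof. by move=> jm; rewrite insubdK. Qed.

Lemma adj_pos j : j.+1 < m -> adj (pos j) (pos j.+1).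
Proof. by move=> jm; rewrite /= /path_adj !val_pos ?eqxx // ltnW. Qed.

Lemma adj_posC j : j.+1 < m -> adj (pos j.+1) (pos j).
Proof. by move=> jm; rewrite adj_sym adj_pos. Qed.

(** The second argument is a length: the layers run from [a] to [a + n - 1]. *)
Definition interval (a n : nat) : seq V := layers H (map pos (iota a n)).

Lemma interval_cat a n n' : interval a (n + n') = interval a n ++ interval (a + n) n'.
Proof. by rewrite /interval iotaD map_cat layers_cat. Qed.

Lemma interval2 a : interval a 2 = layer H (pos a) ++ layer H (pos a.+1).
Proof. by rewrite /interval /= !layers_cons /layers /= cats0. Qed.

Lemma interval_enum : interval 0 m = [seq (i, x) | i <- enum 'I_m, x <- enum H].
Proof.
rewrite /interval /layers; congr (flatten (map _ _)).
apply: (inj_map val_inj); rewrite val_enum_ord -map_comp -[RHS]map_id.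
by apply/eq_in_map => j; rewrite mem_iota add0n /= => jm; apply: val_pos.
Qed.

(** Pair [j] consists of the layers [2 * j] and [(2 * j).+1]; the pairs before it are nested, each
    absorbed by the next. *)
Lemma pocket_left j : 2 * j < m -> pocket (pos (2 * j)) (interval 0 (2 * j)).
Proof.
elim: j => [|j IH] jm; first exact: pocket_nil.
have -> : 2 * j.+1 = 2 * j + 2 by lia.
rewrite interval_cat add0n interval2 addn2.
by apply: pocket_extend (IH _) E; [apply: adj_pos|apply: adj_pos|]; lia.
Qed.

(** The mirror image, with [d] pairs after pair [j]; the induction shifts [j], since the nearest
    pair is the outermost of the nest. *)
Lemma pocket_right d j : 2 * (j.+1 + d) = m ->
  pocket (pos (2 * j).+1) (interval (2 * j).+2 (2 * d)).
Proof.
elim: d j => [|d IH] j jm; first exact: pocket_nil.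
have {IH} p : pocket (pos (2 * j).+3) (interval (2 * j).+4 (2 * d)).
  have -> : (2 * j).+2 = 2 * j.+1 by lia.
  by apply: IH; lia.
have -> : 2 * d.+1 = 2 + 2 * d by lia.
rewrite interval_cat interval2 addn2; apply: pocket_perm (@pocket_extend _ _ _ (pos (2 * j).+2) _ _ _ _ p E).
- by perm_lia.
- by apply: adj_posC; lia.
- by apply: adj_posC; lia.
Qed.

(** Pair [i] absorbs everything before it; the next [e] pairs are crossed without detours. *)
Lemma hpath_through i e a x : 2 * (i + e) + 1 < m -> a \in [:: 2 * i; (2 * i).+1] ->
  exists y, hpath ((pos a, x) : V) (pos (2 * (i + e)).+1, y)
              (interval 0 (2 * (i + e)).+2).
Proof.
move=> + ai; elim: e => [|e IH] im.
  rewrite addn0 in im *; rewrite -[X in interval 0 X]addn2 interval_cat add0n interval2.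
  apply: hpath_exit E _; first by apply: adj_pos; lia.
    by apply: pocket_left; lia.
  by move: ai; rewrite !inE => /orP[] /eqP->; rewrite eqxx ?orbT.
have [|y h] := IH; first by lia.
have e1 : 2 * (i + e.+1) = (2 * (i + e)).+2 by lia.
rewrite e1 in im *; exists x.
rewrite -[X in interval 0 X]addn2 interval_cat add0n interval2.
have ad : adj (pos (2 * (i + e)).+1) (pos (2 * (i + e)).+2) by apply: adj_pos; lia.
have ad' : adj (pos (2 * (i + e)).+2) (pos (2 * (i + e)).+3) by apply: adj_pos; lia.
have h' := hpath_cross x x ad' (pocket_nil H _) (pocket_nil H _) E.
exact: hpath_cat h (lex_adj_layers _ _ ad) h'.
Qed.

(** The pairs before that of [b] are swept from [a]; the pair of [b] absorbs everything after it, on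
    a path built backwards from [y]. *)
Lemma hpath_all_lt k a b x y : m = 2 * k -> b < m -> a./2 < b./2 ->
  hpath ((pos a, x) : V) (pos b, y) (interval 0 m).
Proof.
move=> mk bm ab; pose i := a./2; pose j := b./2; pose e := j - i.+1.
have je : j = (i + e).+1 by rewrite /e /i /j; lia.
have jk : j < k by rewrite /j; lia.
have [||z h] := @hpath_through i e a x; first by lia.
  by rewrite /i !inE; lia.
have [|||w] := @hpath_exit G H (pos (2 * j).+1) (pos (2 * j))
   (interval (2 * j).+2 (2 * (k - j.+1))) y (pos b) _ _ E.
- by apply: adj_posC; lia.
- by apply: pocket_right; lia.
- have [->|->] : b = (2 * j).+1 \/ b = 2 * j by rewrite /j; lia.
    by rewrite inE eqxx.
  by rewrite !inE eqxx orbT.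
move=> /hpath_sym h'.
have mE : m = 2 * j + (2 + 2 * (k - j.+1)) by lia.
rewrite [X in interval _ X]mE interval_cat add0n interval_cat interval2 addn2.
have ej : (2 * (i + e)).+2 = 2 * j by lia.
have ad : @adj V (pos (2 * (i + e)).+1, z) (pos (2 * j), w).
  by apply: lex_adj_layers; rewrite -ej; apply: adj_pos; lia.
rewrite ej in h; apply: hpath_perm (hpath_cat h ad h'); perm_lia.
Qed.

(** What precedes the common pair is a pocket of its first layer, what follows it a pocket of its
    second. *)
Lemma hpath_all_eq k a b x y : m = 2 * k -> (2 < m).+1 <= #|edges H| ->
  a < m -> b < m -> a./2 = b./2 -> (a == b) ==> (x != y) ->
  hpath ((pos a, x) : V) (pos b, y) (interval 0 m).
Proof.
move=> mk E2 am bm ab xy; pose i := a./2.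
have ik : i < k by rewrite /i; lia.
have mE : m = 2 * i + (2 + 2 * (k - i.+1)) by lia.
rewrite [X in interval _ X]mE interval_cat add0n interval_cat interval2 addn2.
have pl : pocket (pos (2 * i)) (interval 0 (2 * i)) by apply: pocket_left; lia.
have pr : pocket (pos (2 * i).+1) (interval (2 * i).+2 (2 * (k - i.+1))).
  by apply: pocket_right; lia.
have ad : adj (pos (2 * i)) (pos (2 * i).+1) by apply: adj_pos; lia.
have ad' : adj (pos (2 * i).+1) (pos (2 * i)) by apply: adj_posC; lia.
(* With a single pair both pockets are empty, so one edge suffices even for two ends in the same
   layer. *)
have small : m <= 2 -> interval 0 (2 * i) = [::]
                       /\ interval (2 * i).+2 (2 * (k - i.+1)) = [::].
  move=> m2; have -> : k - i.+1 = 0 by lia.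
  by have -> : i = 0 by lia.
have [aE|aE] : a = 2 * i \/ a = (2 * i).+1 by rewrite /i; lia.
all: have [bE|bE] : b = 2 * i \/ b = (2 * i).+1 by rewrite /i ab; lia.
all: move: xy; rewrite aE bE ?eqxx /= => xy.
- case: (ltnP 2 m) E2 => [m2 E2|/small[-> ->] _].
    by apply: hpath_perm (hpath_same2 ad pl pr E2 xy); perm_lia.
  by apply: hpath_perm (hpath_same ad (pocket_nil _ _) E xy); perm_lia.
- by apply: hpath_perm (hpath_cross x y ad pl pr E); perm_lia.
- by apply: hpath_perm (hpath_cross x y ad' pr pl E); perm_lia.
- case: (ltnP 2 m) E2 => [m2 E2|/small[-> ->] _].
    by apply: hpath_perm (hpath_same2 ad' pr pl E2 xy); perm_lia.
  by apply: hpath_perm (hpath_same ad' (pocket_nil _ _) E xy); perm_lia.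
Qed.

End Assembly.

Lemma edges_hamiltonian_connected k (H : sgraph) :
  (2 < 2 * k).+1 <= #|edges H| ->
  hamiltonian_connected (lex_product (path_graph (2 * k)) H).
Proof.
move=> E2 x y xy.
have E : 0 < #|edges H| by apply: leq_trans E2.
have posE (z : lex_product (path_graph (2 * k)) H) : z = (pos x.1 (val z.1), z.2).
  by case: z => z1 z2; congr pair; apply: val_inj; rewrite /= val_pos.
suff [p [px pl pp]] : hpath x y (interval H x.1 0 (2 * k)).
  rewrite interval_enum in pp; exists p; split=> // [|z].
    rewrite (perm_uniq pp) allpairs_uniq ?enum_uniq // => -[a b] [c d] _ _ [-> ->] //.
  rewrite (perm_mem pp); apply/allpairsP; exists z; rewrite !mem_enum; split=> //.
  by case: z.
rewrite [X in hpath X]posE [X in hpath _ X]posE.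
have [lt|gt|eq] := ltngtP (val x.1)./2 (val y.1)./2.
- by apply: (@hpath_all_lt _ _ _ E k) => //; apply: ltn_ord.
- by apply: hpath_sym; apply: (@hpath_all_lt _ _ _ E k) => //; apply: ltn_ord.
apply: (@hpath_all_eq _ _ _ E k) => //; try exact: ltn_ord.
apply/implyP => /eqP e; apply: contra_notN xy => /eqP e2.
by rewrite [x]posE [y]posE e e2.
Qed.

Theorem theorem9 (k : nat) (H : sgraph) (hk : 1 <= k)
    (hH : 0 < #|H|) (hH1 : k = 1 -> 1 < #|H|) :
  hamiltonian_connected (lex_product (path_graph (2 * k)) H) <->
    ((k = 1 -> 1 <= pi_lf H) /\ (1 < k -> 2 <= pi_lf H)).
Proof.
rewrite !leq_pi_lf //; split=> [hc|[h1 h2]].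
  have le : (2 < 2 * k).+1 <= #|edges H|.
    by apply: hamiltonian_connected_edges hc => //; [lia | move=> k2; apply: hH1; lia].
  by split=> h; apply: leq_trans le; lia.
apply: edges_hamiltonian_connected => //.
case: (ltnP 1 k) => k1; first by apply: leq_trans (h2 k1); lia.
have -> : k = 1 by lia.
by apply: h1; lia.
Qed.
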